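(* Let $Y$ be a real vector space, $A\subseteq Y$ nonempty and $k\in Y\setminus\{0\}$. (a) For $y^0\in A+\mathbb{R}k$ and $y^1\in0^+A+\mathbb{R}k$, we have $y^0+y^1\in A+\mathbb{R}k$ and $$\varphi_{A,k}(y^0+y^1)\le\varphi_{A,k}(y^0)+\varphi_{0^+A,k}(y^1).$$ (b) If $A$ is a proper subset of $Y$ and $k\in-\operatorname{core}0^+A$, then $\varphi_{A,k}$ and $\varphi_{0^+A,k}$ are finite-valued (real-valued on all of $Y$) and $$\varphi_{A,k}(y^0)-\varphi_{A,k}(y^1)\le\varphi_{0^+A,k}(y^0-y^1)\quad\text{for all } y^0,y^1\in Y.$$ (c) If $A$ is $k$-directionally closed, then $0^+A$ is $k$-directionally closed.
   Context: For nonempty $B\subseteq Y$ and $k\in Y\setminus\{0\}$, $\varphi_{B,k}(y):=\inf\{t\in\mathbb{R}\mid y\in B+tk\}$ for $y\in Y$, where $\inf\emptyset:=\nu$ with $\nu$ a symbol not in $\mathbb{R}\cup\{-\infty,+\infty\}$, and the infimum is $-\infty$ if the set is unbounded below. (On $B+\mathbb{R}k$ the values lie in $\mathbb{R}\cup\{-\infty\}$; sums in $\mathbb{R}\cup\{-\infty\}$ with a summand $-\infty$ equal $-\infty$.) The recession cone of $A$ is $0^+A:=\{u\in Y\mid\forall a\in A\ \forall t\in[0,\infty):\ a+tu\in A\}$. $\operatorname{core}B$ is the algebraic interior of $B$: $b\in\operatorname{core}B$ iff $b\in B$ and for each $v\in Y$ there is $\varepsilon>0$ with $b+sv\in B$ for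 all $s\in[0,\varepsilon]$. A set $B$ is $k$-directionally closed if for every $y\in Y$: whenever there is a sequence $(t_n)$ of positive reals decreasing to $0$ with $y-t_nk\in B$ for all $n$, then $y\in B$. *)

(* Defs.v *)
From HB Require Import structures.
From mathcomp Require Import all_boot all_order all_algebra.
From mathcomp Require Import all_classical all_reals all_analysis.

Set Implicit Arguments.
Unset Strict Implicit.
Unset Printing Implicit Defensive.

Import Order.TTheory GRing.Theory Num.Theory.
Import numFieldNormedType.Exports.

Local Open Scope classical_set_scope.
Local Open Scope ring_scope.

(* The extended reals with an extra symbol nu, the infimum of the empty set:
   [None] is nu and [Some x] is the extended real x. *)
Definition nu_ereal (R : realType) : Type := option (\bar R).

(* Sums and differences are nu as soon as one operand is nu; on [Some] they are
   those of [\bar R], where -oo + x = -oo for every x. *)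
Definition nu_add (R : realType) (x y : nu_ereal R) : nu_ereal R :=
  match x, y with Some a, Some b => Some (a + b)%E | _, _ => None end.

Definition nu_sub (R : realType) (x y : nu_ereal R) : nu_ereal R :=
  match x, y with Some a, Some b => Some (a - b)%E | _, _ => None end.

(* An inequality involving nu never holds. *)
Definition nu_le (R : realType) (x y : nu_ereal R) : Prop :=
  match x, y with Some a, Some b => (a <= b)%E | _, _ => False end.

Definition translate (R : realType) (Y : lmodType R) (B : set Y) (v : Y) :
  set Y := [set b + v | b in B].

Definition add_line (R : realType) (Y : lmodType R) (B : set Y) (k : Y) :
  set Y := [set y | exists b : Y, B b /\ exists t : R, y = b + t *: k].

Definition phi (R : realType) (Y : lmodType R) (B : set Y) (k y : Y) :
    nu_ereal R :=
  let T : set R := [set t : R | translate B (t *: k) y] in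
  if `[< T !=set0 >] then Some (ereal_inf [set t%:E | t in T]) else None.

Definition finite_valued (R : realType) (Y : lmodType R)
    (f : Y -> nu_ereal R) : Prop :=
  forall y : Y, exists r : R, f y = Some r%:E.

Definition recession_cone (R : realType) (Y : lmodType R) (A : set Y) :
  set Y := [set u | forall a : Y, A a -> forall t : R, 0 <= t -> A (a + t *: u)].

Definition algebraic_core (R : realType) (Y : lmodType R) (B : set Y) :
  set Y := [set b | B b /\ forall v : Y, exists2 eps : R, 0 < eps &
                      forall s : R, 0 <= s <= eps -> B (b + s *: v)].

Definition directionally_closed (R : realType) (Y : lmodType R) (k : Y)
    (B : set Y) : Prop :=
  forall y : Y,
    (exists t : R^nat, [/\ forall n, 0 < t n, nonincreasing_seq t,
                           t @ \oo --> (0 : R) &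
                           forall n, B (y - t n *: k)]) ->
    B y.

(* Main.v *)
Require Import Defs.
From HB Require Import structures.
From mathcomp Require Import all_boot all_order all_algebra.
From mathcomp Require Import all_classical all_reals all_analysis.

Set Implicit Arguments.
Unset Strict Implicit.
Unset Printing Implicit Defensive.

Import Order.TTheory GRing.Theory Num.Theory.
Import numFieldNormedType.Exports.

Local Open Scope classical_set_scope.
Local Open Scope ring_scope.

(** Write [level B k y] for the set of reals [t] with [y - t *: k] in [B], so
    that [phi B k y] is its infimum.

    Sublinear estimate: since [A + 0^+A] is contained in [A], adding a level of
    [y0] for [A] to a level of [y1] for [0^+A] gives a level of [y0 + y1] for
    [A] ([level_recession]).  The infimum over such sums is the sum of the
    infima ([le_add_ereal_inf]).

    Finiteness: if [u := - k] lies in the core of the cone [0^+A], then every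
    vector [v] is absorbed, [v + s *: u] being in [0^+A] for some real [s]
    ([core_recession_absorbs]).  Starting from a point of [A], absorption
    reaches some [y - t *: k] on every line, so levels exist; and if
    all of [y + t *: u], [t] real, were in [A], absorption starting from
    [y - s *: u] would reach every [z], making [A] the whole space
    ([phi_finite]).  The cone [0^+A] is recessive along itself, so the same
    argument applies to it in place of [A].  The Lipschitz-type inequality is
    then the sublinear estimate at [y0 = y1 + (y0 - y1)], where all values
    are real and may be subtracted.

    Directional closedness: a sequence [t n] witnessing that [u] is a directional
    limit of [0^+A] rescales to the sequence [r * t n], witnessing that
    [a + r *: u] is a directional limit of [A]. *)

Definition level (R : realType) (Y : lmodType R) (B : set Y) (k y : Y) :
  set R := [set t | B (y - t *: k)].

Lemma phiE (R : realType) (Y : lmodType R) (B : set Y) (k y : Y) :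
  level B k y !=set0 ->
  phi B k y = Some (ereal_inf [set t%:E | t in level B k y]).
Proof.
rewrite /phi; have -> : [set t | translate B (t *: k) y] = level B k y.
  apply/seteqP; split=> t; rewrite /level /=.
    by move=> [b Bb <-]; rewrite addrK.
  by move=> Byt; exists (y - t *: k) => //; rewrite subrK.
by move=> ne; case: asboolP.
Qed.

Lemma add_lineP (R : realType) (Y : lmodType R) (B : set Y) (k y : Y) :
  add_line B k y <-> level B k y !=set0.
Proof.
split=> [[b [Bb [t ->]]]|[t Bt]]; first by exists t; rewrite /level /= addrK.
by exists (y - t *: k); split=> //; exists t; rewrite subrK.
Qed.

(** Fixing [t] and minimizing over [s] gives [L - t <= ereal_inf S]; if that
    infimum is real it can be moved across before minimizing over [t], and if
    it is -oo then [L = -oo].  It is not +oo because [S] is nonempty; otherwise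
    an infimum -oo of [T] would make the sum -oo while the hypothesis on
    [L] is vacuous. *)
Lemma le_add_ereal_inf (R : realType) (S T : set R) (L : \bar R) :
  S !=set0 -> T !=set0 ->
  (forall s t, S s -> T t -> (L <= (s + t)%:E)%E) ->
  (L <= ereal_inf [set s%:E | s in S] + ereal_inf [set t%:E | t in T])%E.
Proof.
move=> [s0 Ss0] [t0 Tt0] LST.
have LS t : T t -> (L - t%:E <= ereal_inf [set s%:E | s in S])%E.
  move=> Tt; apply: le_ereal_inf_tmp => _ [s Ss <-].
  by rewrite leeBlDr // -EFinD; exact: LST.
have : (ereal_inf [set s%:E | s in S] <= s0%:E)%E.
  by apply: ge_ereal_inf; exists s0%:E => //; exists s0.
case: (ereal_inf [set s%:E | s in S]) LS => [r|//|] LS _.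
- rewrite addeC -leeBlDr //; apply: le_ereal_inf_tmp => _ [t Tt <-].
  by rewrite leeBlDr // addeC -leeBlDr //; exact: LS.
- by have := LS _ Tt0; rewrite leeBlDr.
Qed.

Lemma recession_coneZ (R : realType) (Y : lmodType R) (A : set Y) (u : Y)
    (r : R) :
  0 <= r -> recession_cone A u -> recession_cone A (r *: u).
Proof. by move=> r0 Au a Aa t t0; rewrite scalerA; apply: Au; rewrite ?mulr_ge0. Qed.

Lemma recession_cone_step (R : realType) (Y : lmodType R) (A : set Y) (a u : Y) :
  A a -> recession_cone A u -> A (a + u).
Proof. by move=> Aa Au; rewrite -[u]scale1r; apply: Au. Qed.

Lemma recession_cone_sub (R : realType) (Y : lmodType R) (A : set Y) :
  recession_cone A `<=` recession_cone (recession_cone A).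
Proof.
move=> u Au v Av t t0 a Aa s s0.
by rewrite scalerDr addrA scalerA; apply: Au; [exact: Av|exact: mulr_ge0].
Qed.

Lemma algebraic_core_sub (R : realType) (Y : lmodType R) (B C : set Y) :
  B `<=` C -> algebraic_core B `<=` algebraic_core C.
Proof.
move=> BC b [Bb coreb]; split; first exact: BC.
by move=> v; have [e e0 Be] := coreb v; exists e => // s /Be/BC.
Qed.

(** [u + e *: v] is in the cone for some [e > 0]; divide by [e]. *)
Lemma core_recession_absorbs (R : realType) (Y : lmodType R) (A : set Y)
    (u v : Y) :
  algebraic_core (recession_cone A) u ->
  exists s : R, recession_cone A (v + s *: u).
Proof.
move=> [_ /(_ v) [e e0 coreu]]; exists e^-1.
have -> : v + e^-1 *: u = e^-1 *: (u + e *: v).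
  by rewrite scalerDr scalerA mulVf ?gt_eqF// scale1r addrC.
by apply: recession_coneZ; rewrite ?invr_ge0 ?ltW//; apply: coreu; rewrite ltW /=.
Qed.

Lemma level_recession (R : realType) (Y : lmodType R) (A : set Y)
    (k y0 y1 : Y) (s t : R) :
  level A k y0 s -> level (recession_cone A) k y1 t ->
  level A k (y0 + y1) (s + t).
Proof.
rewrite /level /= => As At.
by rewrite scalerDl opprD addrACA; exact: recession_cone_step.
Qed.

Lemma phi_recession_le (R : realType) (Y : lmodType R) (A : set Y)
    (k y0 y1 : Y) :
  level A k y0 !=set0 -> level (recession_cone A) k y1 !=set0 ->
  nu_le (phi A k (y0 + y1))
        (nu_add (phi A k y0) (phi (recession_cone A) k y1)).
Proof.
move=> ne0 ne1; have [s0 As0] := ne0; have [t0 At0] := ne1.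
have ne01 : level A k (y0 + y1) !=set0.
  by exists (s0 + t0); exact: level_recession.
rewrite !phiE //=; apply: le_add_ereal_inf => // s t As At.
apply: ge_ereal_inf; exists (s + t)%:E => //.
by exists (s + t) => //; exact: level_recession.
Qed.

Lemma level_nonempty (R : realType) (Y : lmodType R) (A : set Y) (u y : Y) :
  A !=set0 -> algebraic_core (recession_cone A) u -> level A (- u) y !=set0.
Proof.
move=> [a Aa] /(core_recession_absorbs (y - a)) [s As]; exists s.
rewrite /level /= scalerN opprK.
by have := recession_cone_step Aa As; rewrite addrA subrKC.
Qed.

Lemma level_up (R : realType) (Y : lmodType R) (A : set Y) (u y : Y) (s t : R) :
  recession_cone A u -> s <= t -> level A (- u) y s -> level A (- u) y t.
Proof.
rewrite /level /= !scalerN !opprK => Au st As.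
have -> : y + t *: u = (y + s *: u) + (t - s) *: u.
  by rewrite -addrA -scalerDl subrKC.
by apply: Au; rewrite ?subr_ge0.
Qed.

(** Levels are upward closed, so it is enough to exhibit one real that cannot
    be a level: a point far enough down the line from which an absorbed vector
    would lead, inside [A], to a point [z] outside [A]. *)
Lemma level_bounded_below (R : realType) (Y : lmodType R) (A : set Y)
    (u y : Y) :
  A `<` [set: Y] -> algebraic_core (recession_cone A) u ->
  exists m : R, forall t, level A (- u) y t -> m <= t.
Proof.
rewrite properEneq => -[/setTPn[z nAz] _] coreu.
have [s As] := core_recession_absorbs (z - y) coreu.
(* [- s] cannot be a level: a step by [z - y + s *: u] from [y - s *: u]
   ends at [z]. *)
exists (- s) => t At; rewrite leNgt; apply/negP => ts; apply: nAz.
have := level_up (proj1 coreu) (ltW ts) At.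
rewrite /level /= scalerN opprK scaleNr => Ays.
have := recession_cone_step Ays As.
by rewrite addrACA subrKC addNr addr0.
Qed.

Lemma phi_finite (R : realType) (Y : lmodType R) (A : set Y) (u : Y) :
  A !=set0 -> A `<` [set: Y] -> algebraic_core (recession_cone A) u ->
  finite_valued (phi A (- u)).
Proof.
move=> neA ltA coreu y; have ne := level_nonempty y neA coreu.
rewrite phiE //; have [t At] := ne.
have [m lem] := level_bounded_below y ltA coreu.
set I := ereal_inf _.
have mI : (m%:E <= I)%E.
  by apply: le_ereal_inf_tmp => _ [r Ar <-]; rewrite lee_fin lem.
have It : (I <= t%:E)%E by apply: ge_ereal_inf; exists t%:E => //; exists t.
by case: I mI It => [r _ _|//|//]; exists r.
Qed.

Lemma recession_cone_proper (R : realType) (Y : lmodType R) (A : set Y) :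
  A !=set0 -> A `<` [set: Y] -> recession_cone A `<` [set: Y].
Proof.
rewrite !properEneq => -[a Aa] [/setTPn[z nAz] _]; split=> //.
apply/setTPn; exists (z - a) => Aza; apply: nAz.
by have := recession_cone_step Aa Aza; rewrite subrKC.
Qed.

Lemma directionally_closed_recession (R : realType) (Y : lmodType R)
    (A : set Y) (k : Y) :
  directionally_closed k A -> directionally_closed k (recession_cone A).
Proof.
move=> clA u [t [t0 tdec tcvg Aut]] a Aa r.
rewrite le_eqVlt => /predU1P [<-|r0]; first by rewrite scale0r addr0.
apply: clA; exists (fun n => r * t n); split.
- by move=> n; rewrite mulr_gt0.
- by move=> m n mn; rewrite ler_pM2l //; exact: tdec.
- by rewrite -(mulr0 r); apply: cvgM => //; exact: cvg_cst.
- move=> n; have -> : a + r *: u - (r * t n) *: k = a + r *: (u - t n *: k).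
    by rewrite scalerBr scalerA addrA.
  by apply: Aut => //; exact: ltW.
Qed.

Theorem proposition4 (R : realType) (Y : lmodType R) (A : set Y) (k : Y)
    (hA : A !=set0) (hk : k <> 0) :
  [/\ forall y0 y1 : Y,
        add_line A k y0 -> add_line (recession_cone A) k y1 ->
        add_line A k (y0 + y1) /\
        nu_le (phi A k (y0 + y1))
              (nu_add (phi A k y0) (phi (recession_cone A) k y1)),
      A `<` [set: Y] ->
      [set - u | u in algebraic_core (recession_cone A)] k ->
      [/\ finite_valued (phi A k),
          finite_valued (phi (recession_cone A) k) &
          forall y0 y1 : Y,
            nu_le (nu_sub (phi A k y0) (phi A k y1))
                  (phi (recession_cone A) k (y0 - y1))] &
      directionally_closed k A -> directionally_closed k (recession_cone A)].
Proof.
split.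
- move=> y0 y1 /add_lineP ne0 /add_lineP ne1; split; last first.
    exact: phi_recession_le.
  apply/add_lineP; have [[s As] [t At]] := (ne0, ne1).
  by exists (s + t); exact: level_recession.
- move=> ltA [u coreu <-].
  have coreu2 := algebraic_core_sub (@recession_cone_sub _ _ A) coreu.
  have neC : recession_cone A !=set0 by exists u; exact: (proj1 coreu).
  have finA := phi_finite hA ltA coreu.
  have finC := phi_finite neC (recession_cone_proper hA ltA) coreu2.
  split=> // y0 y1.
  have := phi_recession_le (level_nonempty y1 hA coreu)
    (level_nonempty (y0 - y1) neC coreu2).
  rewrite subrKC.
  have [[r0 ->] [r1 ->] [r ->]] := And3 (finA y0) (finA y1) (finC (y0 - y1)).
  by rewrite /= -EFinD !lee_fin lerBlDl.
- exact: directionally_closed_recession.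
Qed.
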